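(* Let $k_1,k_2$ be positive integers. Let $\Delta_{k_1,k_2}=\langle\lambda^{(1)},\dots,\lambda^{(k_1+1)}\rangle$ be the plane partition of format $(k_1+1)\times(k_1+k_2+1)\times(k_2+1)$ with $\lambda^{(i)}_j=(k_1+k_2+1)-(i+j-1)$ for $1\le i\le k_1+1$ and $1\le j\le k_2+1$. Then $\Delta_{k_1,k_2}$ is the unique maximal plane partition, with respect to the ordering $\subseteq$, among the plane partitions of format $(k_1+1)\times(k_1+k_2+1)\times(k_2+1)$ that allow nondegenerate hypermatrices.
   Context: Fix a field $\mathbb F$ with algebraic closure $\overline{\mathbb F}$. A hypermatrix of format $(k_1+1)\times(k_1+k_2+1)\times(k_2+1)$ over $\mathbb F$ is an array $M=(a_{i_1,i_2,i_3})$ with entries in $\mathbb F$, $1\le i_1\le k_1+1$, $1\le i_2\le k_1+k_2+1$, $1\le i_3\le k_2+1$. Its slices in the first direction are the $(k_1+k_2+1)\times(k_2+1)$ matrices $M_{i}=(a_{i,i_2,i_3})_{i_2,i_3}$, $1\le i\le k_1+1$. $M$ is nondegenerate if its (Cayley / Gelfand–Kapranov–Zelevinsky) hyperdeterminant is nonzero; for this format this is known to be equivalent to the condition, which may be taken as the definition, that every linear combination $c_1M_1+\dots+c_{k_1+1}M_{k_1+1}$ with $c_i\in\overline{\mathbb F}$ not all zero has full rank $k_2+1$. An integer partition $\lambda$ of format $m\times n$ is a sequence $m\ge\lambda_1\ge\dots\ge\lambda_n\ge0$ of integers; $\mu\subseteq\lambda$ means $\mu_j\le\lambda_j$ for all $j$.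 A plane partition of format $(k_1+1)\times(k_1+k_2+1)\times(k_2+1)$ is a sequence $P=\langle\lambda^{(1)},\dots,\lambda^{(k_1+1)}\rangle$ of integer partitions of format $(k_1+k_2+1)\times(k_2+1)$ with $\lambda^{(i+1)}\subseteq\lambda^{(i)}$ for $1\le i\le k_1$. For $P'=\langle\mu^{(1)},\dots,\mu^{(k_1+1)}\rangle$, write $P'\subseteq P$ if $\mu^{(i)}\subseteq\lambda^{(i)}$ for all $i$. $M$ respects $P$ if $a_{i_1,i_2,i_3}=0$ whenever $i_2>k_1+k_2+1-\lambda^{(i_1)}_{i_3}$. $P$ allows nondegenerate hypermatrices if some nondegenerate hypermatrix over $\mathbb F$ respects $P$. *)

(* Defs.v *)
From HB Require Import structures.
From mathcomp Require Import all_boot all_order all_algebra.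

Set Implicit Arguments.
Unset Strict Implicit.
Unset Printing Implicit Defensive.

Import GRing.Theory.
Local Open Scope ring_scope.

(* Ordinals are 0-based: the index written i (1 <= i <= n) on paper is i.+1
   for (i : 'I_n). *)

Definition hypermatrix (R : Type) (n1 n2 n3 : nat) : Type :=
  'I_n1 -> 'I_n2 -> 'I_n3 -> R.

Definition slice (R : Type) (n1 n2 n3 : nat) (M : hypermatrix R n1 n2 n3)
    (i : 'I_n1) : 'M[R]_(n2, n3) :=
  \matrix_(i2 < n2, i3 < n3) M i i2 i3.

(* Nonvanishing of the hyperdeterminant in the boundary format
   (k1+1) x (k1+k2+1) x (k2+1), through its standard characterization.
   The map iota embeds F into its algebraic closure Fbar. *)
Definition nondegenerate (F : fieldType) (Fbar : closedFieldType)
    (iota : {rmorphism F -> Fbar}) (k1 k2 : nat)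
    (M : hypermatrix F k1.+1 (k1 + k2).+1 k2.+1) : Prop :=
  forall c : 'I_k1.+1 -> Fbar, (exists i, c i != 0) ->
    \rank (\sum_(i < k1.+1) c i *: map_mx iota (slice M i))%R = k2.+1.

Definition is_partition (m n : nat) (lam : {ffun 'I_n -> nat}) : Prop :=
  (forall j, (lam j <= m)%N) /\
  (forall j j' : 'I_n, (j <= j')%N -> (lam j' <= lam j)%N).

Definition subpart (n : nat) (mu lam : {ffun 'I_n -> nat}) : Prop :=
  forall j, (mu j <= lam j)%N.

Definition is_plane_partition (n1 n2 n3 : nat)
    (P : {ffun 'I_n1 -> {ffun 'I_n3 -> nat}}) : Prop :=
  (forall i, is_partition n2 (P i)) /\
  (forall i i' : 'I_n1, i' = i.+1 :> nat -> subpart (P i') (P i)).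

Definition subplane (n1 n3 : nat)
    (Q P : {ffun 'I_n1 -> {ffun 'I_n3 -> nat}}) : Prop :=
  forall i, subpart (Q i) (P i).

Definition respects (F : fieldType) (n1 n2 n3 : nat)
    (M : hypermatrix F n1 n2 n3)
    (P : {ffun 'I_n1 -> {ffun 'I_n3 -> nat}}) : Prop :=
  forall (i1 : 'I_n1) (i2 : 'I_n2) (i3 : 'I_n3),
    (n2 - P i1 i3 < i2.+1)%N -> M i1 i2 i3 = 0.

Definition allows_nondegenerate (F : fieldType) (Fbar : closedFieldType)
    (iota : {rmorphism F -> Fbar}) (k1 k2 : nat)
    (P : {ffun 'I_k1.+1 -> {ffun 'I_k2.+1 -> nat}}) : Prop :=
  exists M : hypermatrix F k1.+1 (k1 + k2).+1 k2.+1,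
    nondegenerate iota M /\ respects M P.

Definition maximal_allowing (F : fieldType) (Fbar : closedFieldType)
    (iota : {rmorphism F -> Fbar}) (k1 k2 : nat)
    (P : {ffun 'I_k1.+1 -> {ffun 'I_k2.+1 -> nat}}) : Prop :=
  [/\ is_plane_partition (k1 + k2).+1 P,
      allows_nondegenerate iota P
    & forall Q : {ffun 'I_k1.+1 -> {ffun 'I_k2.+1 -> nat}},
        is_plane_partition (k1 + k2).+1 Q -> allows_nondegenerate iota Q ->
        subplane P Q -> Q = P].

(* The truncated subtractions are exact: 1 <= i.+1 + j.+1 - 1 <= k1 + k2 + 1. *)
Definition Delta (k1 k2 : nat) : {ffun 'I_k1.+1 -> {ffun 'I_k2.+1 -> nat}} :=
  [ffun i : 'I_k1.+1 => [ffun j : 'I_k2.+1 =>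
     ((k1 + k2).+1 - (i.+1 + j.+1 - 1))%N]].

(* Main.v *)
Require Import Defs.
From HB Require Import structures.
From mathcomp Require Import all_boot all_order all_algebra.
From mathcomp Require Import zify.
From Stdlib Require Import Classical.

Set Implicit Arguments.
Unset Strict Implicit.
Unset Printing Implicit Defensive.

Import GRing.Theory.
Local Open Scope ring_scope.

(* A plane partition not contained in Delta forces, for some i and j, the first
   j+1 columns of the first i+1 slices to vanish below the first i+j rows, with
   i and j counted from 0.  These entries form a system of i+j bilinear forms in
   (i+1) + (j+1) variables, and such a system always has a common zero (x, y)
   with x and y nonzero, so M is degenerate.

   The common zero is found with Macaulay inverse systems.  Let V_d be the dual
   of the space of polynomials of bidegree (d, d), and L_d the subspace of V_d
   killed by contraction with all the forms.  If L_d vanished for large d, dim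
   V_d would be O(d^(i+j-1)), while it is C(i+d, i) C(j+d, j); so L_d is never
   0.  As in the Cartier-Tate proof of the projective Nullstellensatz, one then
   imposes further linear forms on L as long as it stays nonzero; over an
   algebraically closed field this stops only when the annihilator of L is a
   hyperplane, that is, a point a of P(K^(i+1) (x) K^(j+1)) (if the annihilator
   is smaller, a pencil of contractions has an eigenvector).  The relation
   x_p y_q . x_p' y_q' = x_p y_q' . x_p' y_q makes a a rank one tensor x (x) y.
*)

(** * Monotone sequences and eigenvectors *)

Lemma nonincreasing_eventually_const (f : nat -> nat) (D : nat) :
  (forall d, (D <= d)%N -> (f d.+1 <= f d)%N) ->
  exists2 E, (D <= E)%N & forall d, (E <= d)%N -> f d = f E.
Proof.
have [n] := ubnP (f D); elim: n D => // n IHn D ltfn fD.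
have [fconst|] := classic (forall d, (D <= d)%N -> f d = f D).
  by exists D.
case/not_all_ex_not=> d nd; have [leDd neq_fd] := imply_to_and _ _ nd.
have lefd : (f d <= f D)%N.
  rewrite -(subnKC leDd); elim: (d - D)%N => [|e IHe]; first by rewrite addn0.
  by rewrite addnS; apply: leq_trans IHe; apply: fD; rewrite leq_addr.
have [||E leE fE] := IHn d; first by move/eqP: neq_fd; lia.
  by move=> d' led'; apply: fD; lia.
by exists E => //; lia.
Qed.

Lemma closed_eigenvalue (K : closedFieldType) (n : nat) (A : 'M[K]_n) :
  (0 < n)%N -> exists a, exists2 v : 'rV_n, v *m A = a *: v & v != 0.
Proof.
move=> n_gt0; have /closed_rootP[a] : size (char_poly A) != 1%N.
  by rewrite size_char_poly; case: n n_gt0 {A}.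
by rewrite -eigenvalue_root_char => /eigenvalueP av; exists a.
Qed.

(** * Graded inverse systems and their points *)

Section InverseSystem.

Variables (K : closedFieldType) (m : nat) (N : nat -> nat).
(** Row vectors of length [N d] stand for functionals in degree [d], and [Y d r] for contraction by
    the [r]-th generator, acting on the right. *)
Variable Y : forall d, 'I_m -> 'M[K]_(N d.+1, N d).

Hypothesis Ycomm : forall d r s, Y d.+1 r *m Y d s = Y d.+1 s *m Y d r.
Hypothesis Yfaithful : forall d (u : 'rV_(N d.+1)),
  (forall r, u *m Y d r = 0) -> u = 0.

Definition contraction d (w : 'rV[K]_m) := \sum_r w 0 r *: Y d r.
Local Notation Z := contraction.

Definition inverse_system (L : forall d, 'M[K]_(N d)) :=
  [/\ forall d r, (L d.+1 *m Y d r <= L d)%MS & forall d, L d != 0].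

Lemma contraction_delta d r : Z d (delta_mx 0 r) = Y d r.
Proof.
rewrite /Z (bigD1 r) //= mxE !eqxx scale1r big1 ?addr0 // => s /negPf ne_sr.
by rewrite mxE ne_sr scale0r.
Qed.

Lemma contractionD d v w : Z d (v + w) = Z d v + Z d w.
Proof.
by rewrite -big_split; apply: eq_bigr => r _; rewrite mxE scalerDl.
Qed.

Lemma contractionZ d a w : Z d (a *: w) = a *: Z d w.
Proof.
by rewrite /Z scaler_sumr; apply: eq_bigr => r _; rewrite mxE scalerA.
Qed.

Lemma contractionC d v w : Z d.+1 v *m Z d w = Z d.+1 w *m Z d v.
Proof.
rewrite /Z !mulmx_suml.
under eq_bigr do rewrite mulmx_sumr.
under [RHS]eq_bigr do rewrite mulmx_sumr.
rewrite exchange_big; apply: eq_bigr => r _; apply: eq_bigr => s _.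
by rewrite -!scalemxAl -!scalemxAr !scalerA mulrC Ycomm.
Qed.

Lemma contraction_sub L d w (u : 'rV_(N d.+1)) :
  inverse_system L -> (u <= L d.+1)%MS -> (u *m Z d w <= L d)%MS.
Proof.
case=> LY _ uL; rewrite mulmx_sumr summx_sub // => r _.
by rewrite -scalemxAr scalemx_sub // (submx_trans (submxMr _ uL)).
Qed.

(** Nothing lies below degree 0, so [L] is left unchanged there. *)
Definition kernel_system L w d : 'M[K]_(N d) :=
  match d with
  | 0 => L 0%N
  | d'.+1 => (L d'.+1 :&: kermx (Z d' w))%MS
  end.

Lemma sub_kernel_system L w d (u : 'rV_(N d.+1)) :
  (u <= kernel_system L w d.+1)%MS =
  (u <= L d.+1)%MS && (u *m Z d w == 0).
Proof. by rewrite sub_capmx; congr (_ && _); apply/sub_kermxP/eqP. Qed.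

Lemma kernel_systemS L w d : (kernel_system L w d <= L d)%MS.
Proof. by case: d => [|d] /=; rewrite ?capmxSl. Qed.

Lemma kernel_inverse_system L w : inverse_system L ->
  (forall d, kernel_system L w d != 0) -> inverse_system (kernel_system L w).
Proof.
move=> Lsys Kn0; split=> // -[|d] r; apply/row_subP=> i; rewrite row_mul;
  set u := row i _; rewrite -contraction_delta.
  apply: (@contraction_sub L) => //.
  exact: submx_trans (row_sub _ _) (kernel_systemS _ _ _).
have /andP[uL /eqP uw] : (u <= L d.+2)%MS && (u *m Z d.+1 w == 0).
  by rewrite -sub_kernel_system row_sub.
rewrite sub_kernel_system contraction_sub //=.
by rewrite -mulmxA contractionC mulmxA uw mul0mx.
Qed.

(** Vanishing propagates upwards: a generator contracts a kernel element into the kernel one degree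
    lower, where it is 0, and [Yfaithful] concludes. *)
Lemma kernel_system_eq0 L w d : inverse_system L ->
  kernel_system L w d = 0 ->
  forall e (u : 'rV_(N e.+1)), (d <= e)%N ->
    (u <= L e.+1)%MS -> u *m Z e w = 0 -> u = 0.
Proof.
move=> Lsys; case: d => [|d] K0; first by case: Lsys => _ /(_ 0%N)/eqP[].
have K0u (u : 'rV_(N d.+1)) : (u <= L d.+1)%MS -> u *m Z d w = 0 -> u = 0.
  move=> uL uw; apply/eqP; rewrite -submx0 -K0 sub_kernel_system uL uw eqxx.
  by [].
suff inj e : (d <= e)%N ->
    forall u : 'rV_(N e.+1), (u <= L e.+1)%MS -> u *m Z e w = 0 -> u = 0.
  by move=> e u /ltnW/inj; apply.
elim: e => [|e IHe].
  by rewrite leqn0 => /eqP d0; case: _ / (esym d0) in K0u *.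
rewrite leq_eqVlt => /predU1P[<- //|/IHe{}IHe] u uL uw.
apply: Yfaithful => r; rewrite -contraction_delta.
apply: IHe; first exact: contraction_sub.
by rewrite -mulmxA contractionC mulmxA uw mul0mx.
Qed.

(* Contraction along v is bijective on L in large degrees, so an eigenvector of
   (contraction v)^-1 * (contraction w) in one degree is transported to all
   higher degrees by (contraction v)^-1. *)
Lemma eventually_injective_pencil L (v w : 'rV[K]_m) : inverse_system L ->
    (exists d, kernel_system L v d = 0) ->
  exists a, forall d, kernel_system L (w - a *: v) d != 0.
Proof.
move=> Lsys [D /(kernel_system_eq0 Lsys) injv].
(* By injectivity the ranks of [L d] are nonincreasing from [D] on, so they stabilize; from then on
   contraction along [v] is also onto. *)
have rkL d : (D <= d)%N -> \rank (L d.+1 *m Z d v) = \rank (L d.+1).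
  move=> leDd; rewrite -(mxrank_mul_ker (L d.+1) (Z d v)).
  rewrite -[LHS]addn0; congr addn; apply/esym/eqP; rewrite mxrank_eq0.
  apply/eqP/row_matrixP=> i; rewrite row0; apply: (injv d) => //.
    by rewrite (submx_trans (row_sub _ _)) ?capmxSl.
  by apply/sub_kermxP; rewrite (submx_trans (row_sub _ _)) ?capmxSr.
have subL d z : (L d.+1 *m Z d z <= L d)%MS.
  by apply/row_subP=> i; rewrite row_mul contraction_sub // row_sub.
have [E leDE Lconst] : exists2 E, (D <= E)%N &
    forall d, (E <= d)%N -> \rank (L d) = \rank (L E).
  apply: (nonincreasing_eventually_const (f := fun d => \rank (L d))).
  by move=> d leDd; rewrite -rkL // mxrankS.
have surj d : (E <= d)%N -> (L d <= L d.+1 *m Z d v)%MS.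
  move=> leEd; rewrite -(mxrank_leqif_sup (subL d v)) rkL ?(leq_trans leDE) //.
  by rewrite !Lconst // leqW.
pose B := row_base (L E.+1).
(* [C] represents the pencil in the basis [B]; an eigenvector [x] of [C] yields [x *m B], killed by
   [w - a *: v]. *)
have /submxP[C defC] : (B *m Z E w <= B *m Z E v)%MS.
  have eB : (B :=: L E.+1)%MS := eq_row_base _.
  rewrite (eqmxMr _ eB) (eqmxMr _ eB).
  by apply: submx_trans (surj E (leqnn E)).
have [|a [x xC x_n0]] := closed_eigenvalue C.
  by rewrite lt0n mxrank_eq0; case: Lsys.
have [u [uL uw u_n0]] : exists u : 'rV_(N E.+1),
    [/\ (u <= L E.+1)%MS, u *m Z E (w - a *: v) = 0 & u != 0].
  exists (x *m B); split.
  - by rewrite (submx_trans (submxMl _ _)) ?eq_row_base.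
  - rewrite contractionD -scaleN1r !contractionZ scaleN1r mulmxBr -scalemxAr.
    by rewrite -!(mulmxA x B) defC (mulmxA x C) xC -scalemxAl subrr.
  apply: contra_neq x_n0 => xB0.
  by apply: (row_free_inj (row_base_free (L E.+1))); rewrite xB0 mul0mx.
exists a => d; apply/eqP => /(kernel_system_eq0 Lsys)/(_ (E + d)%N) K0.
suff [u' [u'L u'w /eqP[]]] : exists u : 'rV_(N (E + d).+1),
    [/\ (u <= L (E + d).+1)%MS, u *m Z (E + d) (w - a *: v) = 0 & u != 0].
  by apply: K0; rewrite ?leq_addl.
elim: {K0}d => [|e [u' [u'L u'w u'_n0]]].
  by rewrite addn0; exists u.
rewrite addnS; set e' := (E + e)%N in u' u'L u'w u'_n0 *.
have leE : (E <= e'.+1)%N by rewrite leqW // leq_addr.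
have /submxP[x' def_u'] := submx_trans u'L (surj _ leE).
have def_u'2 : u' = x' *m L e'.+2 *m Z e'.+1 v by rewrite -mulmxA.
exists (x' *m L e'.+2); split; first exact: submxMl.
  (* Contraction along [v] is injective here and commutes with that along [w - a *: v], which
     reduces the claim to [u'w]. *)
  apply: (injv e') => //; first by lia.
    by apply: contraction_sub; rewrite ?submxMl.
  by rewrite -mulmxA contractionC mulmxA -def_u'2.
by apply: contra_neq u'_n0 => x0; rewrite def_u'2 x0 mul0mx.
Qed.

(** Induction on the codimension of [I]. If some [w] outside [I] has a kernel system nonzero in
    every degree, [L] is replaced by it and [I] grows by [w]. Otherwise [I] is a hyperplane, and
    modulo [I] each generator is a multiple of [v], which gives [a]. *)
Lemma inverse_system_point_sub L (I : 'M[K]_m) : inverse_system L ->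
    (forall d (w : 'rV_m), (w <= I)%MS -> L d.+1 *m Z d w = 0) ->
  exists L' (a v : 'rV[K]_m), [/\ inverse_system L',
    forall d, (L' d <= L d)%MS &
    forall d r, L' d.+1 *m Y d r = a 0 r *: (L' d.+1 *m Z d v)].
Proof.
have [n] := ubnP (m - \rank I); elim: n => // n IHn in L I *.
move=> ltIn Lsys LI.
have add w : ~~ (w <= I)%MS -> (forall d, kernel_system L w d != 0) ->
    exists L' (a v : 'rV[K]_m), [/\ inverse_system L',
    forall d, (L' d <= L d)%MS &
    forall d r, L' d.+1 *m Y d r = a 0 r *: (L' d.+1 *m Z d v)].
  move=> wI Kn0.
  have ltI : (\rank I < \rank (I + w)%MS)%N.
    apply: rank_ltmx; rewrite ltmxE addsmxSl /=.
    by apply: contra wI; apply: submx_trans; apply: addsmxSr.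
  have := rank_leq_col (I + w)%MS => leIm.
  have [|||L' [a [v [L's L'L L'Y]]]] := IHn (kernel_system L w) (I + w)%MS.
  - by move: ltIn ltI leIm; lia.
  - exact: kernel_inverse_system.
  - move=> d _ /sub_addsmxP[[x y] /= ->].
    rewrite [y]mx11_scalar mul_scalar_mx contractionD contractionZ mulmxDr.
    have -> : kernel_system L w d.+1 *m Z d (x *m I) = 0.
      apply/eqP; rewrite -submx0.
      apply: submx_trans (submxMr _ (kernel_systemS L w d.+1)) _.
      by rewrite LI ?submxMl ?sub0mx.
    rewrite add0r -scalemxAr; apply/eqP; rewrite scaler_eq0; apply/orP; right.
    by apply/eqP/sub_kermxP; rewrite capmxSr.
  exists L', a, v; split=> // d.
  exact: submx_trans (L'L d) (kernel_systemS _ _ _).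
(* [I] is proper: otherwise all generators would kill [L 1], which is nonzero. *)
have [full|/row_subPn[i]] := boolP (1%:M <= I)%MS.
  case: (Lsys) => _ /(_ 1%N)/eqP[]; apply/row_matrixP=> i; rewrite row0.
  apply: Yfaithful => r; rewrite -row_mul -contraction_delta LI ?row0 //.
  exact: submx_trans (submx1 _) full.
set v := row i _ => vI.
have [/(add v vI)//|/not_all_ex_not[d /negP/negPn/eqP Kv0]] :=
  classic (forall d, kernel_system L v d != 0).
(* For [w] outside [I + v], no [w - a *: v] lies in [I], so the pencil lemma supplies a new form to
   impose. *)
have [full|/row_subPn[j]] := boolP (1%:M <= I + v)%MS; last first.
  set w := row j _ => wIv.
  have [|a Kw] := @eventually_injective_pencil L v w Lsys; first by exists d.
  apply: add Kw; apply: contra wIv => wI.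
  rewrite -(subrK (a *: v) w) addmx_sub ?scalemx_sub ?addsmxSr //.
  exact: submx_trans wI (addsmxSl _ _).
have decomp r : exists a, (delta_mx 0 r - a *: v <= I)%MS.
  have /sub_addsmxP[[x y] /= e] :=
    submx_trans (submx1 (delta_mx 0 r : 'rV_m)) full.
  exists (y 0 0); rewrite e [y]mx11_scalar mul_scalar_mx !mxE mulr1n addrK.
  exact: submxMl.
have /fin_all_exists[a aP] := decomp.
exists L, (\row_r a r), v; split=> // e r.
apply/eqP; rewrite -subr_eq0 mxE scalemxAr -mulmxBr -contraction_delta.
rewrite -contractionZ -scaleN1r -contractionZ -contractionD scaleN1r.
by rewrite LI.
Qed.

(** Degrees 2, 1 and 0 suffice, because the relations used to obtain a rank one tensor are quadratic
    in the generators. *)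
Lemma inverse_system_point L : inverse_system L ->
  exists (a : 'rV[K]_m) (u : 'rV_(N 2)) (t : 'rV_(N 1)) (s : 'rV_(N 0)),
    [/\ a != 0, s != 0, (u <= L 2)%MS,
        forall r, u *m Y 1 r = a 0 r *: t & forall r, t *m Y 0 r = a 0 r *: s].
Proof.
move=> Lsys; have [|L' [a [v [L'sys L'L L'Y]]]] :=
    @inverse_system_point_sub L 0 Lsys.
  move=> d w; rewrite submx0 => /eqP ->; rewrite /Z big1 ?mulmx0 // => r _.
  by rewrite mxE scale0r.
have uY d (u : 'rV_(N d.+1)) r : (u <= L' d.+1)%MS ->
    u *m Y d r = a 0 r *: (u *m Z d v).
  by case/submxP=> x ->; rewrite -!mulmxA L'Y !mulmxA -scalemxAr mulmxA.
have inj d (u : 'rV_(N d.+1)) : (u <= L' d.+1)%MS -> u *m Z d v = 0 -> u = 0.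
  by move=> uL' uv; apply: Yfaithful => r; rewrite uY // uv scaler0.
have [u uL' u_n0] : exists2 u : 'rV_(N 2), (u <= L' 2)%MS & u != 0.
  by apply/rowV0Pn; case: L'sys.
have tL' := contraction_sub v L'sys uL'.
exists a, u, (u *m Z 1 v), (u *m Z 1 v *m Z 0 v); split.
- apply: contra_neq u_n0 => a0; apply: Yfaithful => r.
  by rewrite uY // a0 mxE scale0r.
- by apply: contra_neq u_n0 => /(inj _ _ tL')/(inj _ _ uL').
- exact: submx_trans uL' (L'L _).
- by move=> r; apply: uY.
- by move=> r; apply: uY.
Qed.

End InverseSystem.

(** * Dimension growth under commuting operators *)

Section CommonKernel.

Variables (K : fieldType) (N : nat -> nat).
Variable F : nat -> forall d, 'M[K]_(N d.+1, N d).

Fixpoint common_kernel r d : 'M[K]_(N d) :=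
  match r, d with
  | r'.+1, d'.+1 => (common_kernel r' d'.+1 :&: kermx (F r' d'))%MS
  | r'.+1, 0 => common_kernel r' 0
  | 0, _ => 1%:M
  end.

Lemma common_kernel0 r : common_kernel r 0 = 1%:M.
Proof. by elim: r. Qed.

Lemma sub_common_kernel r d (u : 'rV_(N d.+1)) :
  reflect (forall k, (k < r)%N -> u *m F k d = 0)
    (u <= common_kernel r d.+1)%MS.
Proof.
elim: r => [|r IHr] /=; first by rewrite submx1; constructor.
rewrite sub_capmx; apply: (iffP andP) => [[/IHr uF /sub_kermxP uFr] k|uF].
  by rewrite ltnS leq_eqVlt => /predU1P[-> //|]; apply: uF.
split; first by apply/IHr => k ltkr; rewrite uF // leqW.
by apply/sub_kermxP; rewrite uF.
Qed.

Lemma common_kernel_stable r (G : forall d, 'M[K]_(N d.+1, N d)) :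
  (forall k d, (k < r)%N -> F k d.+1 *m G d = G d.+1 *m F k d) ->
  forall d, (common_kernel r d.+1 *m G d <= common_kernel r d)%MS.
Proof.
move=> FG [|d]; first by rewrite common_kernel0 submx1.
apply/row_subP=> i; rewrite row_mul; set u := row i _.
have /sub_common_kernel uF : (u <= common_kernel r d.+2)%MS by apply: row_sub.
by apply/sub_common_kernel=> k ltkr; rewrite -mulmxA -FG // mulmxA uF ?mul0mx.
Qed.

Hypothesis Fcomm : forall k l d, F k d.+1 *m F l d = F l d.+1 *m F k d.

Local Notation h r d := (\rank (common_kernel r d)).

(** Rank-nullity for [F r], which by commutation maps [common_kernel r] into itself one degree down,
    with kernel [common_kernel r.+1]. *)
Lemma rank_common_kernelS r d : (h r d.+1 <= h r d + h r.+1 d.+1)%N.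
Proof.
rewrite -(mxrank_mul_ker _ (F r d)) leq_add2r mxrankS //.
by apply: common_kernel_stable => *; apply: Fcomm.
Qed.

Lemma rank_common_kernel_sum r d :
  (h r d <= N 0%N + \sum_(e < d) h r.+1 e.+1)%N.
Proof.
elim: d => [|d IHd]; first by rewrite common_kernel0 mxrank1 leq_addr.
by rewrite big_ord_recr addnA (leq_trans (rank_common_kernelS r d)) ?leq_add2r.
Qed.

(* Each equation lowers the order of growth in d by at most one. *)
Lemma common_kernel_growth n : (0 < n)%N ->
    (exists D, forall d, (D <= d)%N -> common_kernel n d.+1 = 0) ->
  exists C, forall d, (N d <= C * d.+1 ^ n.-1)%N.
Proof.
case: n => // n' _ [D KD] /=.
(* The form [n' - n'] prepares an induction on [k]: with [n' - k] equations imposed, the growth has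
   order at most [k]. At [k = n'] no equation is left. *)
suff [C hC] : exists C, forall d, (h (n' - n') d <= C * d.+1 ^ n')%N.
  by exists C => d; move: (hC d); rewrite subnn mxrank1.
have : (n' <= n')%N by [].
move: {-2 3}n' => k; elim: k => [_|k IHk ltkn].
  exists (N 0%N + \sum_(e < D) h n'.+1 e.+1)%N => d.
  rewrite subn0 muln1 (leq_trans (rank_common_kernel_sum _ _)) // leq_add2l.
  rewrite -2!(big_mkord xpredT (fun e => h n'.+1 e.+1)).
  have [leDd|/ltnW ltdD] := leqP D d; last first.
    by rewrite [leqRHS](@big_cat_nat _ _ _ d) //= leq_addr.
  have tail0 : (\sum_(D <= e < d) h n'.+1 e.+1 = 0)%N.
    by rewrite big_nat big1 // => e /andP[leDe _]; rewrite KD ?mxrank0.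
  by rewrite (@big_cat_nat _ _ _ D) //= tail0 addn0.
(* [N 0] pays for degree 0, and [C] for the increments. *)
have [C hC] := IHk (ltnW ltkn); exists (N 0 + C)%N.
elim=> [|d IHd]; first by rewrite common_kernel0 mxrank1 exp1n muln1 leq_addr.
apply: leq_trans (rank_common_kernelS _ _) _.
have := hC d.+1; rewrite -subSn // subSS => hCd.
have le2 : (d.+1 ^ k <= d.+2 ^ k)%N by case: (k) => // k'; rewrite leq_exp2r.
by move: IHd; rewrite !expnS; move: hCd le2; nia.
Qed.

End CommonKernel.

(** * Monomials of a given degree *)

Definition is_monomial m d (t : m.+1.-tuple 'I_d.+1) :=
  (\sum_(i <- t) i == d)%N.

(** Bounding the exponents by [d] gives a finite type, in the shape counted by
    [card_ord_partitions]. *)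
Definition monomial m d := {t : m.+1.-tuple 'I_d.+1 | is_monomial t}.

Definition expo m d (x : monomial m d) (p : 'I_m.+1) : nat := tnth (val x) p.

Lemma card_monomial m d : #|{: monomial m d}| = 'C(m + d, m).
Proof. by rewrite card_sig -card_ord_partitions cardsE. Qed.

Lemma expo_sum m d (x : monomial m d) : (\sum_p expo x p)%N = d.
Proof. by have /eqP := valP x; rewrite big_tuple. Qed.

Lemma expo_inj m d (x y : monomial m d) : expo x =1 expo y -> x = y.
Proof. by move=> xy; apply/val_inj/eq_from_tnth => p; apply/val_inj/xy. Qed.

Lemma monomialP m d (f : 'I_m.+1 -> nat) :
  (\sum_p f p)%N = d -> {x : monomial m d | expo x =1 f}.
Proof.
move=> f_sum; have lef p : (f p < d.+1)%N.
  by rewrite ltnS -f_sum (bigD1 p) //= leq_addr.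
pose t := [tuple Ordinal (lef p) | p < m.+1].
have tm : is_monomial t.
  rewrite /is_monomial big_tuple -[X in _ == X]f_sum; apply/eqP.
  by apply: eq_bigr => p _; rewrite tnth_mktuple.
by exists (exist _ t tm) => p; rewrite /expo /= tnth_mktuple.
Qed.

Lemma mulvar_sum m d (x : monomial m d) (p : 'I_m.+1) :
  (\sum_q (expo x q + (q == p)) = d.+1)%N.
Proof.
rewrite big_split /= expo_sum (bigD1 p) //= eqxx big1 ?addn1 // => q.
by move/negPf->.
Qed.

Definition mulvar m d (p : 'I_m.+1) (x : monomial m d) : monomial m d.+1 :=
  sval (monomialP (mulvar_sum x p)).

Lemma expo_mulvar m d p (x : monomial m d) q :
  expo (mulvar p x) q = (expo x q + (q == p))%N.
Proof. exact: (svalP (monomialP _)). Qed.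

Lemma mulvarC m d p q (x : monomial m d) :
  mulvar p (mulvar q x) = mulvar q (mulvar p x).
Proof. by apply: expo_inj => r; rewrite !expo_mulvar addnAC. Qed.

Lemma mulvar_surj m d (x : monomial m d.+1) : exists p y, x = mulvar p y.
Proof.
have [p xp | x0] := pickP (fun p => 0 < expo x p)%N; last first.
  by have := expo_sum x; rewrite big1 // => p _; have := x0 p; case: expo.
have y_sum : (\sum_q (expo x q - (q == p)) = d)%N.
  apply: succn_inj; apply: etrans (expo_sum x).
  rewrite [RHS](bigD1 p) //= (bigD1 p) //= eqxx.
  rewrite -addSn subn1 prednK //; congr (_ + _)%N.
  by apply: eq_bigr => q /negPf->; rewrite subn0.
have [y yE] := monomialP y_sum; exists p, y; apply: expo_inj => q.
by rewrite expo_mulvar yE; case: eqP => [->|_]; rewrite ?subnK ?subn0 ?addn0.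
Qed.

(** * Common zeros of bilinear forms *)

Section Bilinear.

Variables (K : closedFieldType) (i j : nat).
Variable f : 'I_(i + j) -> 'I_i.+1 -> 'I_j.+1 -> K.

Definition bimonomial d := (monomial i d * monomial j d)%type.

Local Notation N d := #|{: bimonomial d}|.
Local Notation index := ('I_i.+1 * 'I_j.+1)%type.

Definition shift d (r : index) (x : 'I_(N d)) : 'I_(N d.+1) :=
  enum_rank (mulvar r.1 (enum_val x).1, mulvar r.2 (enum_val x).2).

(** A row vector lists the values of a functional on monomials, so this is the transpose of
    multiplication by x_p y_q, where [r] is [(p, q)]. *)
Definition shift_mx d (r : index) : 'M[K]_(N d.+1, N d) :=
  colsub (shift r) 1%:M.

Lemma mulmx_shift_mx d r (u : 'rV_(N d.+1)) :
  u *m shift_mx d r = colsub (shift r) u.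
Proof. by rewrite mulmx_colsub mulmx1. Qed.

Lemma shift_mx_comp d r s :
  shift_mx d.+1 r *m shift_mx d s = colsub (shift r \o shift s) 1%:M.
Proof. by rewrite mulmx_colsub mulmx1; apply/matrixP => a b; rewrite !mxE. Qed.

Lemma shift_mx_exchange d p p' q q' :
  shift_mx d.+1 (p, q) *m shift_mx d (p', q') =
  shift_mx d.+1 (p, q') *m shift_mx d (p', q).
Proof.
rewrite !shift_mx_comp; apply: eq_colsub => x /=.
by rewrite /shift !enum_rankK /=; congr (enum_rank (_, _)); rewrite mulvarC.
Qed.

Lemma shift_mxC d r s :
  shift_mx d.+1 r *m shift_mx d s = shift_mx d.+1 s *m shift_mx d r.
Proof.
rewrite !shift_mx_comp; apply: eq_colsub => x /=.
by rewrite /shift !enum_rankK /= mulvarC [X in (_, X)]mulvarC.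
Qed.

(** Every bimonomial of positive bidegree is divisible by some x_p y_q, so each entry of [u] is read
    off a contraction. *)
Lemma shift_mx_faithful d (u : 'rV_(N d.+1)) :
  (forall r, u *m shift_mx d r = 0) -> u = 0.
Proof.
move=> u0; apply/rowP=> x.
have [p [y Ey]] := mulvar_surj (enum_val x).1.
have [q [z Ez]] := mulvar_surj (enum_val x).2.
have /rowP/(_ (enum_rank (y, z))) := u0 (p, q).
rewrite mulmx_shift_mx !mxE => <-; congr (u 0 _).
by rewrite /shift enum_rankK /= -Ey -Ez -surjective_pairing enum_valK.
Qed.

Lemma card_bimonomial d : N d = ('C(i + d, i) * 'C(j + d, j))%N.
Proof. by rewrite card_prod !card_monomial. Qed.

(** The right side is the product of the integers d+1, ..., d+m. *)
Lemma leq_exp_bin m d : (d.+1 ^ m <= m`! * 'C(m + d, m))%N.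
Proof.
rewrite mulnC bin_ffact; elim: m => // m IHm.
by rewrite expnS addSn ffactSS leq_mul // ltnS leq_addl.
Qed.

Lemma bimonomial_growth d : (d.+1 ^ (i + j) <= i`! * j`! * N d)%N.
Proof.
rewrite card_bimonomial mulnACA expnD leq_mul ?leq_exp_bin //.
Qed.

(** Extended by 0 to all naturals, the index type of [common_kernel]. *)
Definition form_mx (k : nat) d : 'M[K]_(N d.+1, N d) :=
  if insub k is Some k' then \sum_r f k' r.1 r.2 *: shift_mx d r else 0.

Lemma form_mx_ord (k : 'I_(i + j)) d :
  form_mx k d = \sum_r f k r.1 r.2 *: shift_mx d r.
Proof. by rewrite /form_mx valK. Qed.

Lemma form_mx_shift_mxC k d r :
  form_mx k d.+1 *m shift_mx d r = shift_mx d.+1 r *m form_mx k d.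
Proof.
rewrite /form_mx; case: insubP => [k' _ _|_]; last by rewrite mul0mx mulmx0.
rewrite mulmx_suml mulmx_sumr; apply: eq_bigr => s _.
by rewrite -scalemxAl -scalemxAr shift_mxC.
Qed.

Lemma form_mxC k l d :
  form_mx k d.+1 *m form_mx l d = form_mx l d.+1 *m form_mx k d.
Proof.
rewrite {1 4}/form_mx.
case: insubP => [k' _ _|_]; last by rewrite mul0mx mulmx0.
rewrite mulmx_suml mulmx_sumr; apply: eq_bigr => s _.
by rewrite -scalemxAl -scalemxAr form_mx_shift_mxC.
Qed.

Local Notation L := (common_kernel form_mx (i + j)).

Lemma bimonomial_gt0 d : (0 < N d)%N.
Proof. by rewrite card_bimonomial muln_gt0 !bin_gt0 !leq_addr. Qed.

Lemma bilinear_kernel_neq0 d : L d != 0.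
Proof.
have [n0|n_gt0] := posnP (i + j).
  rewrite -mxrank_eq0 n0 -lt0n.
  by case: (d) => [|d']; rewrite /= mxrank1 bimonomial_gt0.
apply/eqP=> Ld0.
(* Generators contract [L e.+1] into [L e], so by faithfulness zero propagates to higher degrees. *)
have L0 e : (d <= e)%N -> L e.+1 = 0.
  move=> lede; have: (d <= e.+1)%N by rewrite leqW.
  rewrite -(subnKC lede) -addnS; elim: (e - d).+1 => [|c IHc].
    by rewrite addn0.
  move=> _; rewrite addnS; apply/row_matrixP=> x; rewrite row0.
  apply: shift_mx_faithful => r; rewrite -row_mul.
  have := common_kernel_stable (F := form_mx) (r := i + j) (G := shift_mx^~ r).
  move=> /(_ (fun k d _ => form_mx_shift_mxC k d r) (d + c)%N).
  by rewrite IHc ?leq_addr // submx0 => /eqP ->; rewrite row0.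
have [|C NC] := common_kernel_growth form_mxC n_gt0; first by exists d.
(* In degree [c] the two bounds would give [c.+1 ^ (i + j) <= c * c.+1 ^ (i + j).-1]. *)
pose c := (i`! * j`! * C)%N.
have := leq_trans (bimonomial_growth c) (leq_mul (leqnn _) (NC c)).
rewrite mulnA -/c -{1}(prednK n_gt0) expnS leq_pmul2r ?expn_gt0 //.
by rewrite ltnn.
Qed.

Lemma bilinear_common_zero :
  exists (x : 'I_i.+1 -> K) (y : 'I_j.+1 -> K),
    [/\ exists p, x p != 0, exists q, y q != 0 &
        forall k, \sum_p \sum_q f k p q * (x p * y q) = 0].
Proof.
pose Y d (r : 'I_#|{: index}|) := shift_mx d (enum_val r).
have Lsys : inverse_system Y L.
  split; last exact: bilinear_kernel_neq0.
  move=> d r; apply: (common_kernel_stable (G := fun d => Y d r)) => k e _.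
  exact: form_mx_shift_mxC.
have Yfaithful d (u : 'rV_(N d.+1)) : (forall r, u *m Y d r = 0) -> u = 0.
  move=> u0; apply: shift_mx_faithful => r.
  by have := u0 (enum_rank r); rewrite /Y enum_rankK.
have Ycomm d r s : Y d.+1 r *m Y d s = Y d.+1 s *m Y d r by apply: shift_mxC.
have [a [u [t [s [a_n0 s_n0 uL uY tY]]]]] :=
  inverse_system_point Ycomm Yfaithful Lsys.
pose b p q := a 0 (enum_rank (p, q)).
have ub p q : u *m shift_mx 1 (p, q) = b p q *: t.
  by rewrite -uY /Y enum_rankK.
have tb p q : t *m shift_mx 0 (p, q) = b p q *: s.
  by rewrite -tY /Y enum_rankK.
have t_n0 : t != 0.
  have [r ar_n0] : exists r, a 0 r != 0.
    apply/existsP; apply: contraR a_n0; rewrite negb_exists => /forallP a0.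
    by apply/eqP/rowP=> r; rewrite mxE; apply/eqP; have := a0 r; rewrite negbK.
  apply: contra_neq s_n0 => t0; have := tY r; rewrite t0 mul0mx => /esym/eqP.
  by rewrite scaler_eq0 (negPf ar_n0) => /eqP.
have scal_inj d (z : 'rV[K]_d) c c' : z != 0 -> c *: z = c' *: z -> c = c'.
  move=> /negPf z_n0 /eqP; rewrite -subr_eq0 -scalerBl scaler_eq0 z_n0 orbF.
  by rewrite subr_eq0 => /eqP.
(* Contracting [u] twice yields both products as coefficients of [s]. *)
have rank1 p q p' q' : b p q * b p' q' = b p q' * b p' q.
  apply: (scal_inj _ s) => //; rewrite -!scalerA -!tb !scalemxAl -!ub.
  by rewrite -!mulmxA shift_mx_exchange.
have [p0 [q0 b_n0]] : exists p q, b p q != 0.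
  have /rV0Pn[r ar] := a_n0; exists (enum_val r).1, (enum_val r).2.
  by rewrite /b -surjective_pairing enum_valK.
(* Column [q0] and row [p0] of [b]: by [rank1] their product is [b p0 q0] times [b]. *)
exists (fun p => b p q0), (fun q => b p0 q); split; first by exists p0.
  by exists q0.
move=> k.
(* The [k]-th form contracts [u] to this sum times the nonzero [t], and kills [u] because [u] lies
   in [L 2]. *)
have : \sum_p \sum_q f k p q * b p q = 0.
  apply: (scal_inj _ t) => //; rewrite scale0r.
  have /sub_common_kernel/(_ k (ltn_ord k)) := uL.
  rewrite form_mx_ord => <-; rewrite mulmx_sumr pair_bigA scaler_suml /=.
  by apply: eq_bigr => -[p q] _; rewrite -scalemxAr ub scalerA.
move/(congr1 ( *%R (b p0 q0))); rewrite mulr0 mulr_sumr => fb0.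
rewrite -[RHS]fb0; apply: eq_bigr => p _; rewrite mulr_sumr.
by apply: eq_bigr => q _; rewrite [RHS]mulrCA (rank1 p0) [b p0 q * _]mulrC.
Qed.

End Bilinear.

(** * Nondegenerate hypermatrices and the bound by [Delta] *)

Lemma col_full_rankP (K : fieldType) (m n : nat) (A : 'M[K]_(m, n)) :
  \rank A = n <-> forall y : 'cV_n, A *m y = 0 -> y = 0.
Proof.
split=> [rkA y Ay | injA].
  have freeA : row_free A^T by rewrite /row_free mxrank_tr rkA.
  apply: trmx_inj; apply: (row_free_inj freeA).
  by rewrite -trmx_mul Ay !trmx0 mul0mx.
rewrite -mxrank_tr; apply/eqP; change (row_free A^T); rewrite -kermx_eq0.
apply/eqP/row_matrixP=> i; rewrite row0; set u := row i _.
apply: trmx_inj; rewrite trmx0; apply: injA; apply: trmx_inj.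
by rewrite trmx_mul trmxK trmx0; apply/sub_kermxP; apply: row_sub.
Qed.

Lemma sum_ord_widen (V : zmodType) (m n : nat) (lemn : (m <= n)%N)
    (G : 'I_n -> V) : (forall p : 'I_n, (m <= p)%N -> G p = 0) ->
  \sum_p G p = \sum_(p < m) G (widen_ord lemn p).
Proof.
move=> G0; rewrite -big_ord_narrow [RHS]big_mkcond /=; apply: eq_bigr => p _.
by case: ltnP => // /G0.
Qed.

Section Format.

Variables (F : fieldType) (Fbar : closedFieldType).
Variables (iota : {rmorphism F -> Fbar}) (k1 k2 : nat).

Local Notation format := {ffun 'I_k1.+1 -> {ffun 'I_k2.+1 -> nat}}.

(** Each row [s] gives a bilinear form in [c] and [y]; by [col_full_rankP], degeneracy is a common
    zero of these forms with [c] and [y] both nonzero. *)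
Lemma pencil_mulmx (M : hypermatrix F k1.+1 (k1 + k2).+1 k2.+1)
    (c : 'I_k1.+1 -> Fbar) (y : 'cV_k2.+1) s :
  ((\sum_(i < k1.+1) c i *: map_mx iota (slice M i)) *m y) s 0 =
  \sum_i \sum_j iota (M i s j) * (c i * y j 0).
Proof.
rewrite mulmx_suml summxE; apply: eq_bigr => i _.
rewrite -scalemxAl !mxE mulr_sumr; apply: eq_bigr => j _.
by rewrite !mxE mulrCA.
Qed.

Lemma plane_partition_anti (P : format) (i i' : 'I_k1.+1) (j j' : 'I_k2.+1) :
  is_plane_partition (k1 + k2).+1 P -> (i' <= i)%N -> (j' <= j)%N ->
  (P i j <= P i' j')%N.
Proof.
case=> Ppart Psub lei lej.
apply: leq_trans (proj2 (Ppart i') _ _ lej) => {lej j'}.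
case: i lei => i /= lti; elim: i lti => [|i IHi] lti lei.
  by have -> : Ordinal lti = i' by apply: val_inj => /=; lia.
have [->|ne] := eqVneq i' (Ordinal lti); first by [].
apply: leq_trans (Psub (Ordinal (ltnW lti)) _ _ _) (IHi (ltnW lti) _) => //.
by move: ne lei; rewrite -val_eqE /=; lia.
Qed.

Lemma allows_subplane_Delta (P : format) :
  is_plane_partition (k1 + k2).+1 P -> allows_nondegenerate iota P ->
  subplane P (Delta k1 k2).
Proof.
move=> Ppp [M [Mnd MP]] i j; rewrite !ffunE leqNgt; apply/negP=> ltP.
(* By [ltP], [P i j] is at least [(k1 + k2).+1 - (i + j)], so the zeros start at row [i + j] or
   earlier. *)
have M0 (p : 'I_k1.+1) (s : 'I_(k1 + k2).+1) (q : 'I_k2.+1) :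
    (p <= i)%N -> (q <= j)%N -> (i + j <= s)%N -> M p s q = 0.
  move=> lep leq les; apply: MP; have := plane_partition_anti Ppp lep leq.
  by move: ltP les; have := proj1 (proj1 Ppp i) j; lia.
have lti := ltn_ord i; have ltj := ltn_ord j.
have les : (i + j <= (k1 + k2).+1)%N by lia.
pose f k p q := iota (M (widen_ord lti p) (widen_ord les k) (widen_ord ltj q)).
have [x [y [[p0 xp0] [q0 yq0] fxy]]] := bilinear_common_zero f.
(* The common zero is extended by 0; [inord] is only used within range. *)
pose c (p : 'I_k1.+1) := if (p <= i)%N then x (inord p) else 0.
pose z : 'cV_k2.+1 := \col_q if (q <= j)%N then y (inord q) else 0.
have cE p : c (widen_ord lti p) = x p.
  by rewrite /c /= -ltnS ltn_ord inord_val.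
have zE q : z (widen_ord ltj q) 0 = y q.
  by rewrite mxE /= -ltnS ltn_ord inord_val.
have /Mnd/col_full_rankP/(_ z) : exists p, c p != 0.
  by exists (widen_ord lti p0); rewrite cE.
suff -> : (\sum_(p < k1.+1) c p *: map_mx iota (slice M p)) *m z = 0.
  by move=> /(_ erefl) z0; move: yq0; rewrite -zE z0 mxE eqxx.
apply/matrixP=> s t; rewrite ord1 pencil_mulmx mxE {t}.
have [lts|ges] := ltnP s (i + j); last first.
  apply: big1 => p _; apply: big1 => q _.
  rewrite /c mxE; case: leqP => lep; last by rewrite mul0r mulr0.
  by case: leqP => leq; rewrite ?mulr0 // M0 // rmorph0 mul0r.
rewrite (sum_ord_widen (m := i.+1)) => [|p ltp]; last first.
  by apply: big1 => q _; rewrite /c leqNgt ltp /= mul0r mulr0.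
rewrite -[RHS](fxy (Ordinal lts)); apply: eq_bigr => p _.
rewrite (sum_ord_widen (m := j.+1)) => [|q ltq]; last first.
  by rewrite mxE leqNgt ltq /= !mulr0.
apply: eq_bigr => q _; rewrite cE zE /f; congr (iota (M _ _ _) * _).
exact: val_inj.
Qed.

(* The linear combination of the slices of this hypermatrix with coefficients c
   is the matrix of multiplication by the polynomial of coefficients c. *)
Definition toeplitz : hypermatrix F k1.+1 (k1 + k2).+1 k2.+1 :=
  fun i s j => (nat_of_ord s == i + j)%N%:R.

(** A kernel vector [y] gives [p * q = 0] with [p] nonzero, and polynomials over a field form a
    domain. *)
Lemma toeplitz_nondegenerate : Defs.nondegenerate iota toeplitz.
Proof.
move=> c [i0 ci0]; apply/col_full_rankP=> y Ay.
pose p := \sum_i c i *: 'X^i : {poly Fbar}.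
pose q := \sum_j y j 0 *: 'X^j : {poly Fbar}.
have coef_p (i : 'I_k1.+1) : p`_i = c i.
  rewrite coef_sum (bigD1 i) //= coefZ coefXn eqxx mulr1 big1 ?addr0 // => l li.
  by rewrite coefZ coefXn val_eqE eq_sym (negPf li) mulr0.
have coef_q (j : 'I_k2.+1) : q`_j = y j 0.
  rewrite coef_sum (bigD1 j) //= coefZ coefXn eqxx mulr1 big1 ?addr0 // => l lj.
  by rewrite coefZ coefXn val_eqE eq_sym (negPf lj) mulr0.
have coef_pq s : (p * q)`_s =
    \sum_(i < k1.+1) \sum_(j < k2.+1) (s == i + j)%N%:R * (c i * y j 0).
  rewrite mulr_suml coef_sum; apply: eq_bigr => i _.
  rewrite mulr_sumr coef_sum; apply: eq_bigr => j _.
  by rewrite -scalerAl -scalerAr -exprD !coefZ coefXn mulrA mulrC.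
have pq0 : p * q = 0.
  apply/polyP=> s; rewrite coef_pq coef0.
  have [lts|ges] := ltnP s (k1 + k2).+1.
    have /matrixP/(_ (Ordinal lts) 0) := Ay; rewrite pencil_mulmx mxE => Ays.
    rewrite -[RHS]Ays; apply: eq_bigr => i _; apply: eq_bigr => j _.
    by rewrite rmorph_nat.
  apply: big1 => i _; apply: big1 => j _; have := ltn_ord i; have := ltn_ord j.
  by case: eqP => [|_]; [lia | rewrite mul0r].
have p_n0 : p != 0 by apply: contra_neq ci0 => p0; rewrite -coef_p p0 coef0.
move/eqP: pq0; rewrite mulf_eq0 (negPf p_n0) => /eqP q0.
by apply/colP=> j; rewrite -coef_q q0 coef0 mxE.
Qed.

(** With indices from 0, [Delta] prescribes zeros where [s > i + j], while [toeplitz] is supported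
    on [s = i + j]. *)
Lemma Delta_allows : allows_nondegenerate iota (Delta k1 k2).
Proof.
exists toeplitz; split; first exact: toeplitz_nondegenerate.
move=> i s j; rewrite !ffunE /toeplitz => lts.
by case: eqP => // es; move: lts; have := ltn_ord s; lia.
Qed.

Lemma Delta_plane_partition : is_plane_partition (k1 + k2).+1 (Delta k1 k2).
Proof.
split=> [i|i i' ei j]; last by rewrite !ffunE; lia.
by split=> [j|j j' lej]; rewrite !ffunE; lia.
Qed.

End Format.

Lemma subplane_anti (n1 n3 : nat) (P Q : {ffun 'I_n1 -> {ffun 'I_n3 -> nat}}) :
  subplane P Q -> subplane Q P -> P = Q.
Proof.
move=> PQ QP; apply/ffunP=> i; apply/ffunP=> j; apply/eqP.
by rewrite eqn_leq PQ QP.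
Qed.

Theorem theorem2p18 (F : fieldType) (Fbar : closedFieldType)
    (iota : {rmorphism F -> Fbar})
    (Fbar_algebraic : forall x : Fbar, algebraicOver iota x)
    (k1 k2 : nat) (k1_gt0 : (0 < k1)%N) (k2_gt0 : (0 < k2)%N) :
  maximal_allowing iota (Delta k1 k2) /\
  (forall P : {ffun 'I_k1.+1 -> {ffun 'I_k2.+1 -> nat}},
     maximal_allowing iota P -> P = Delta k1 k2).
Proof.
(* [Delta] is even the greatest of these plane partitions, which yields both claims. *)
split=> [|P [Ppp Pallows Pmax]].
  split=> [||Q Qpp Qallows DQ]; first exact: Delta_plane_partition.
    exact: Delta_allows.
  by apply: subplane_anti DQ; apply: allows_subplane_Delta Qallows.
apply/esym/Pmax; first exact: Delta_plane_partition.
  exact: Delta_allows.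
exact: allows_subplane_Delta Pallows.
Qed.
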